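(* Let $w$ be a permutation avoiding the pattern $1423$, and let $u$ be a subword of $w$. Then $$\sum_{u\le v\le w}(-1)^{|w|-|v|}\,\Upsilon_{\mathrm{perm}(v)}(\beta)\in\mathbb{Z}_{\ge0}[\beta],$$ where the sum is over all subwords $v$ of $w$ that contain $u$ as a subword.
   Context: For $w\in S_n$, the $\beta$-Grothendieck polynomial $\mathfrak{G}^{(\beta)}_w(x)\in\mathbb{Z}[\beta][x_1,\dots,x_n]$ is defined by $\mathfrak{G}^{(\beta)}_{w_0}=x_1^{n-1}\cdots x_{n-1}$ for $w_0=n\cdots21$ and $\mathfrak{G}^{(\beta)}_w=\pi_i\mathfrak{G}^{(\beta)}_{ws_i}$ whenever $w(i)<w(i+1)$, where $\pi_i(f)=\partial_i((1+\beta x_{i+1})f)$, $\partial_if=(f-s_if)/(x_i-x_{i+1})$. $\Upsilon_w(\beta)=\mathfrak{G}^{(\beta)}_w(1,\dots,1)$, $\Upsilon_\emptyset(\beta)=1$. Words have distinct positive integer entries; $u\le v$ means $u$ is a subword (subsequence) of $v$; $|v|$ is the length; $\mathrm{perm}(v)$ is the permutation order-isomorphic to $v$. $w$ avoids $1423$ if no subword $v$ of $w$ has $\mathrm{perm}(v)=1423$. *)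

(* Defs.v *)
From HB Require Import structures.
From mathcomp Require Import all_boot all_order all_algebra all_fingroup.
From mathcomp Require Import mpoly.
From Stdlib Require Import ClassicalEpsilon.

Set Implicit Arguments.
Unset Strict Implicit.
Unset Printing Implicit Defensive.

Import Order.TTheory GRing.Theory Num.Theory.
Local Open Scope ring_scope.

Notation Zb := {poly int}.

(* Words: sequences of (distinct positive) natural numbers; a permutation
   w in S_n is written in one-line notation w(1) ... w(n). *)

Definition stdperm (v : seq nat) : seq nat :=
  [seq count (fun y => (y <= x)%N) v | x <- v].

Definition is_perm_word (w : seq nat) : Prop := perm_eq w (iota 1 (size w)).

Definition avoids1423 (w : seq nat) : Prop :=
  ~ exists v : seq nat, subseq v w /\ stdperm v = [:: 1; 4; 2; 3]%N.

Section Groth.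
Variable n : nat.

(* the variable x_{j+1} (0-based index j), 0 if out of range *)
Definition xv (j : nat) : {mpoly Zb[n]} :=
  if insub j is Some i then 'X_i else 0.

Definition betaM : {mpoly Zb[n]} := ('X : Zb)%:MP.

Definition swapv (j : nat) (f : {mpoly Zb[n]}) : {mpoly Zb[n]} :=
  match insub j, insub j.+1 with
  | Some a, Some b => msym (tperm a b) f
  | _, _ => f
  end.

(* divided difference d_{j+1} f = (f - s_{j+1} f) / (x_{j+1} - x_{j+2}):
   the (unique, {mpoly Zb[n]} being an integral domain) quotient. *)
Definition ddiff (j : nat) (f : {mpoly Zb[n]}) : {mpoly Zb[n]} :=
  epsilon (inhabits 0)
    (fun g => (xv j - xv j.+1) * g = f - swapv j f).

Definition piop (j : nat) (f : {mpoly Zb[n]}) : {mpoly Zb[n]} :=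
  ddiff j ((1 + betaM * xv j.+1) * f).

Definition topmon : {mpoly Zb[n]} := \prod_(i < n) 'X_i ^+ (n.-1 - i).

End Groth.

Definition first_ascent (w : seq nat) : option nat :=
  let j := find (fun k => (nth 0 w k < nth 0 w k.+1)%N) (iota 0 (size w).-1) in
  if (j < (size w).-1)%N then Some j else None.

Definition swap_pos (j : nat) (w : seq nat) : seq nat :=
  set_nth 0%N (set_nth 0%N w j (nth 0%N w j.+1)) j.+1 (nth 0%N w j).

(* G_w, computed by descending from w to w0 = n...21 along first ascents:
   G_{w0} = x_1^{n-1}...x_{n-1}, G_w = pi_i G_{w s_i} when w(i) < w(i+1).
   The fuel k only needs to exceed the number of steps (at most n(n-1)/2). *)
Fixpoint groth_fuel (n k : nat) (w : seq nat) : {mpoly Zb[n]} :=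
  match k with
  | 0 => 0
  | k'.+1 =>
      match first_ascent w with
      | None => topmon n
      | Some j => piop j (groth_fuel n k' (swap_pos j w))
      end
  end.

Definition groth (w : seq nat) : {mpoly Zb[size w]} :=
  groth_fuel (size w) ((size w) ^ 2).+1 w.

(* Upsilon_w(beta) = G_w(1,...,1); Upsilon of the empty word is 1 *)
Definition Upsilon (w : seq nat) : Zb := (groth w).@[fun _ => 1].

Definition nonneg_poly (p : Zb) : Prop := forall k : nat, 0 <= p`_k.

Definition subwords (w : seq nat) : seq (seq nat) :=
  undup [seq mask (val m) w | m : (size w).-tuple bool].

(* Main.v *)
Require Import Defs.
From HB Require Import structures.
From mathcomp Require Import all_boot all_order all_algebra all_fingroup.
From mathcomp Require Import mpoly.
From mathcomp Require Import zify ring.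
Import GRing.Theory.
Local Open Scope ring_scope.
Set Implicit Arguments.
Unset Strict Implicit.
Unset Printing Implicit Defensive.

(** Write f(w) for Upsilon of the pattern of w.  If m is the smallest letter of w = X m R,
    then G_w is obtained from G_{XR} by the operators pi_p pi_{p+1} ... (p = |X| + 1), and
    evaluating the Leibniz rule pi_i (x_i h) = (1 + beta x_{i+1}) h + x_{i+1} pi_i h at
    x = 1 yields f(X m R) = f(X T(R)), where T(R) is a combination of rearrangements of R
    determined by T(r) = r and, with t = 1 + beta,
      T(L y r) = T(L y) r                if y < r,
      T(L y r) = t T(L y) r + T(L r) y   if y > r.

    Call a function of a set V of letters totally monotone if it is a combination of
    indicators [A \subset V] with coefficients in Z>=0[beta].  It suffices to show that
    V |-> f(w restricted to V) [S \subset V] is totally monotone, since inclusion-exclusion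
    extracts from it the coefficient of the full set of letters; the theorem is the case
    S = u.  By induction on the length of w this holds as soon as every occurrence of 1423
    in w has its 2 in S.  The recursion preserves this hypothesis: a letter r which hops to
    the left over y > r can become the 2 of new occurrences, but it may be added to S
    because the corresponding term is present only if r belongs to V.  The hypothesis in
    turn makes the recursion compatible with restriction to V: if m < y < r and y may be
    missing from V, then no letter before y in R exceeds r, so that r is stuck whether or
    not y is in V. *)

(** * Totally monotone set functions *)

Lemma nonneg_polyD (p q : Zb) : nonneg_poly p -> nonneg_poly q -> nonneg_poly (p + q).
Proof. by move=> hp hq k; rewrite coefD Num.Theory.addr_ge0. Qed.

Lemma nonneg_polyM (p q : Zb) : nonneg_poly p -> nonneg_poly q -> nonneg_poly (p * q).
Proof.
move=> hp hq k; rewrite coefM; apply: Num.Theory.sumr_ge0 => i _.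
exact: Num.Theory.mulr_ge0.
Qed.

Lemma nonneg_poly0 : nonneg_poly 0.
Proof. by move=> k; rewrite coef0. Qed.

Lemma nonneg_poly1 : nonneg_poly 1.
Proof. by move=> k; rewrite coef1; case: eqP. Qed.

Lemma nonneg_polyX : nonneg_poly 'X.
Proof. by move=> k; rewrite coefX; case: eqP. Qed.

Lemma nonneg_poly_sum (I : eqType) (s : seq I) (F : I -> Zb) :
  (forall i, i \in s -> nonneg_poly (F i)) -> nonneg_poly (\sum_(i <- s) F i).
Proof.
move=> h; rewrite big_seq; elim/big_ind: _ => //; first exact: nonneg_poly0.
exact: nonneg_polyD.
Qed.

(* A predicate V stands for the set of letters that are kept. *)
Definition totally_monotone (F : pred nat -> Zb) : Prop :=
  exists s : seq (seq nat * Zb),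
    (forall q, q \in s -> nonneg_poly q.2) /\
    forall V, F V = \sum_(q <- s) q.2 *+ all V q.1.

Definition pdel (V : pred nat) (y : nat) : pred nat := fun x => V x && (x != y).

Lemma all_pdel V y A : all (pdel V y) A = all V A && (y \notin A).
Proof.
elim: A => //= x A ->; rewrite /pdel inE negb_or eq_sym.
by case: (V x); case: (y == x); case: (all V A).
Qed.

Lemma filter_pdel V y s : y \notin s -> filter (pdel V y) s = filter V s.
Proof.
move=> hy; apply: eq_in_filter => x hx; rewrite /pdel.
by case: eqP hx hy => [->->|] //; rewrite andbT.
Qed.

Lemma tm_ext F G : F =1 G -> totally_monotone F -> totally_monotone G.
Proof. by move=> FG [s [hs hF]]; exists s; split=> // V; rewrite -FG. Qed.

Lemma tm0 : totally_monotone (fun=> 0).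
Proof. by exists [::]; split=> // V; rewrite big_nil. Qed.

Lemma tm1 : totally_monotone (fun=> 1).
Proof.
exists [:: ([::], 1)]; split=> [q|V]; last by rewrite big_seq1.
by rewrite inE => /eqP->; exact: nonneg_poly1.
Qed.

Lemma tmD F G : totally_monotone F -> totally_monotone G ->
  totally_monotone (fun V => F V + G V).
Proof.
move=> [s [hs hF]] [r [hr hG]]; exists (s ++ r); split=> [q|V].
  by rewrite mem_cat => /orP[/hs|/hr].
by rewrite big_cat hF hG.
Qed.

Lemma tmM c F : nonneg_poly c -> totally_monotone F ->
  totally_monotone (fun V => c * F V).
Proof.
move=> hc [s [hs hF]]; exists [seq (q.1, c * q.2) | q <- s]; split=> [q|V].
  by move=> /mapP[p /hs hp ->]; exact: nonneg_polyM.
by rewrite big_map hF mulr_sumr; apply: eq_bigr => q _ /=; rewrite mulrnAr.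
Qed.

Lemma tm_in y F : totally_monotone F -> totally_monotone (fun V => F V *+ V y).
Proof.
move=> [s [hs hF]]; exists [seq (y :: q.1, q.2) | q <- s]; split=> [q|V].
  by move=> /mapP[p /hs hp ->].
rewrite big_map hF -sumrMnl; apply: eq_bigr => q _ /=.
by rewrite -mulrnA mulnb andbC.
Qed.

Lemma tm_all S F : totally_monotone F -> totally_monotone (fun V => F V *+ all V S).
Proof.
move=> hF; elim: S => [|x S /(tm_in x)]; first exact: hF.
by apply: tm_ext => V /=; rewrite -mulrnA mulnb andbC.
Qed.

Lemma tm_filter (P : pred (seq nat)) (s : seq (seq nat * Zb)) F :
  (forall q, q \in s -> nonneg_poly q.2) ->
  (forall V, F V = \sum_(q <- s | P q.1) q.2 *+ all V q.1) -> totally_monotone F.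
Proof.
move=> hs hF; exists [seq q <- s | P q.1]; split=> [q|V].
  by rewrite mem_filter => /andP[_ /hs].
by rewrite big_filter hF.
Qed.

(** Deleting [y] from [V] kills exactly the terms whose set contains [y], and leaves the others
    unchanged. *)
Lemma tm_pdel y F : totally_monotone F -> totally_monotone (fun V => F (pdel V y)).
Proof.
move=> [s [hs hF]]; apply: (tm_filter (P := fun A => y \notin A) hs) => V.
rewrite hF [RHS]big_mkcond; apply: eq_bigr => q _; rewrite all_pdel.
by case: (y \in q.1); rewrite /= ?andbF ?andbT ?mulr0n.
Qed.

(** The difference keeps exactly the terms whose set contains [y]. They vanish when [y] is missing
    from [V], so the factor [V y] changes nothing. *)
Lemma tm_diff y F : totally_monotone F ->
  totally_monotone (fun V => (F V - F (pdel V y)) *+ V y).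
Proof.
move=> [s [hs hF]]; apply: (tm_filter (P := fun A => y \in A) hs) => V.
rewrite !hF -sumrB -sumrMnl [RHS]big_mkcond; apply: eq_bigr => q _.
rewrite all_pdel; case: ifPn => hy /=; last by rewrite andbT subrr mul0rn.
rewrite andbF mulr0n subr0 -mulrnA mulnb; congr (_ *+ nat_of_bool _).
by case: (boolP (all V q.1)) => // /allP /(_ _ hy) ->.
Qed.

(** * Inclusion-exclusion over subwords *)

Fixpoint sublists (w : seq nat) : seq (seq nat) :=
  if w is x :: w' then map (cons x) (sublists w') ++ sublists w' else [:: [::]].

Lemma mem_sublists w v : (v \in sublists w) = subseq v w.
Proof.
elim: w v => [|x w IH] v /=; first by rewrite inE; case: v.
rewrite mem_cat; case: v => [|y v]; first by rewrite IH sub0seq orbT.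
rewrite !IH /=; case: eqP => [->|hy].
  rewrite mem_map ?IH; last by move=> ? ? [].
  by apply/orP/idP => [[//|]|]; [exact: (subseq_trans (subseq_cons _ _))|left].
rewrite orbC; case: (subseq _ _) => //=; apply/mapP => -[z _ [e _]]; exact: hy.
Qed.

Lemma uniq_sublists w : uniq w -> uniq (sublists w).
Proof.
elim: w => //= x w IH /andP[hx uw].
rewrite cat_uniq IH // map_inj_uniq ?IH //; last by move=> ? ? [].
rewrite andbT /=; apply/hasPn => v; rewrite mem_sublists => /mem_subseq hv.
by apply/mapP => -[z _ e]; rewrite e in hv; move: hx; rewrite hv // mem_head.
Qed.

(** Passes from the enumeration by masks to the recursive one, which suits induction on the word. *)
Lemma subwords_sublists w : uniq w -> perm_eq (subwords w) (sublists w).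
Proof.
move=> uw; apply: uniq_perm; rewrite ?undup_uniq ?uniq_sublists // => v.
rewrite mem_undup mem_sublists; apply/mapP/subseqP => [[m _ ->]|[m sm ->]].
  by exists m; rewrite ?size_tuple.
exists (Tuple (introT eqP sm)); last by [].
by rewrite mem_enum.
Qed.

(* Inclusion-exclusion against [A \subset V] only survives when A covers w. *)
Lemma alternating_sum_all (w A : seq nat) (c : Zb) : nonneg_poly c -> uniq w ->
  nonneg_poly (\sum_(v <- sublists w)
    (-1) ^+ (size w - size v)%N * (c *+ all (mem v) A)).
Proof.
move=> hc; elim: w A => [|x w IH] A /=.
  by move=> _; rewrite big_seq1 mul1r; case: all; [|exact: nonneg_poly0].
move=> /andP[hx uw]; rewrite big_cat big_map /=.
have hsz v : v \in sublists w -> ((size w).+1 - size v = (size w - size v).+1)%N.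
  by rewrite mem_sublists => /size_subseq h; rewrite subSn.
have hxv v : v \in sublists w -> x \notin v.
  by rewrite mem_sublists => /mem_subseq h; apply: contra hx; exact: h.
have -> : \sum_(v <- sublists w) (-1) ^+ ((size w).+1 - size v)%N * (c *+ all (mem v) A)
   = - \sum_(v <- sublists w) (-1) ^+ (size w - size v)%N * (c *+ all (mem v) A).
  rewrite -sumrN big_seq [RHS]big_seq; apply: eq_bigr => v /hsz->.
  by rewrite exprS mulN1r mulNr.
(* If [x] lies in [A], subwords without [x] contribute nothing, and the others reduce to [A] with
   [x] removed. *)
case: (boolP (x \in A)) => hxA.
  have -> : \sum_(v <- sublists w) (-1) ^+ (size w - size v)%N * (c *+ all (mem v) A) = 0.
    rewrite big_seq big1 // => v /hxv hv; case: allP => [/(_ _ hxA) /=|_].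
      by rewrite (negbTE hv).
    by rewrite mulr0n mulr0.
  rewrite oppr0 addr0.
  rewrite (eq_bigr (fun v => (-1) ^+ (size w - size v)%N *
             (c *+ all (mem v) [seq y <- A | y != x]))); first exact: IH.
  move=> v _; rewrite subSS; congr (_ * (_ *+ nat_of_bool _)).
  rewrite all_filter; apply: eq_all => y /=.
  by rewrite !inE; case: eqP.
(* If [x] is not in [A], then [v] and [x :: v] have the same indicator and opposite signs, so the
   sum cancels. *)
have -> : \sum_(v <- sublists w) (-1) ^+ ((size w).+1 - size (x :: v))%N *
    (c *+ all (mem (x :: v)) A)
   = \sum_(v <- sublists w) (-1) ^+ (size w - size v)%N * (c *+ all (mem v) A).
  apply: eq_bigr => v _; rewrite /= subSS; congr (_ * (_ *+ nat_of_bool _)).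
  apply: eq_in_all => y hy; rewrite /= !inE.
  by case: eqP hy hxA => // -> ->.
by rewrite subrr; exact: nonneg_poly0.
Qed.

Lemma alternating_sum_tm (w : seq nat) F : totally_monotone F -> uniq w ->
  nonneg_poly (\sum_(v <- sublists w) (-1) ^+ (size w - size v)%N * F (mem v)).
Proof.
move=> [s [hs hF]] uw.
rewrite (eq_bigr (fun v => \sum_(q <- s) (-1) ^+ (size w - size v)%N *
                     (q.2 *+ all (mem v) q.1))); last by move=> v _; rewrite hF mulr_sumr.
rewrite exchange_big; apply: nonneg_poly_sum => q /hs hq.
exact: alternating_sum_all.
Qed.

(** * Recursion on the smallest letter *)

Lemma min_exists (w : seq nat) : w != [::] ->
  exists2 m, m \in w & forall y, y \in w -> (m <= y)%N.
Proof.
case: w => // x0 w _; pose s := sort leq (x0 :: w).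
have ss : sorted leq s by apply: sort_sorted; exact: leq_total.
have ps : s =i x0 :: w by exact: mem_sort.
case es : s => [|m t]; first by have := ps x0; rewrite es mem_head.
exists m; first by rewrite -ps es mem_head.
move=> y; rewrite -ps es inE => /orP[/eqP->//|yt].
move: ss; rewrite es /= (path_sortedE leq_trans) => /andP[/allP h _]; exact: h.
Qed.

Lemma min_all X m (R : seq nat) : uniq (X ++ m :: R) ->
  (forall y, y \in X ++ m :: R -> (m <= y)%N) -> all (fun y => m < y)%N (X ++ R).
Proof.
move=> uw hm; apply/allP => y hy; rewrite ltn_neqAle hm ?andbT; last first.
  by move: hy; rewrite !mem_cat inE => /orP[] ->; rewrite ?orbT.
apply: contraTneq uw => ->; move: hy; rewrite mem_cat cat_uniq /= => /orP[] h.
  by rewrite h /= !andbF.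
by rewrite h !andbF.
Qed.

Lemma min_split (w : seq nat) : uniq w -> w != [::] ->
  exists (X : seq nat) (m : nat) (R : seq nat),
    w = X ++ m :: R /\ all (fun y => m < y)%N (X ++ R).
Proof.
move=> uw /min_exists[m mw hm]; case/splitPr: mw uw hm => X R uw hm.
by exists X, m, R; split=> //; exact: min_all.
Qed.

Section Hopping.
Variable phi : seq nat -> Zb.

(* [hop phi (rev R) [::]] is phi extended linearly to the combination
     T(R) = (... (R (1 + p_{m-1})) ...) (1 + p_1)
   of words, where p_i sends a word with descent x > y at i to the word with x and y
   exchanged plus beta times the word itself, and kills the words with an ascent at i.
   The current letter r travels to the left; B is the part already processed. *)
Fixpoint hopr (r : nat) (l B : seq nat) : Zb :=
  if l is y :: l' then
    if (y < r)%N then hopr y l' (r :: B)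
    else (1 + 'X) * hopr y l' (r :: B) + hopr r l' (y :: B)
  else phi (r :: B).

Definition hop (l B : seq nat) : Zb := if l is r :: l' then hopr r l' B else phi B.

(** What is gained by letting [r] hop instead of leaving it in place: the terms with coefficient
    beta and those where [r] has passed its left neighbour. Only nonnegative coefficients occur. *)
Definition hop_gain (r : nat) (l B : seq nat) : Zb :=
  if l is y :: l' then
    if (y < r)%N then 0 else 'X * hop (y :: l') (r :: B) + hop (r :: l') (y :: B)
  else 0.

Lemma hop_cons r l B : hop (r :: l) B = hop l (r :: B) + hop_gain r l B.
Proof.
case: l => [|y l] /=; first by rewrite addr0.
by case: ifP; rewrite ?addr0 // mulrDl mul1r addrA.
Qed.

Lemma hop_gain0 r l B : all (fun y => y < r)%N l -> hop_gain r l B = 0.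
Proof. by case: l => //= y l /andP[->]. Qed.

End Hopping.
Arguments hop : simpl never.
Arguments hop_gain : simpl never.

(** * Words in which every 1423 has its 2, the letter [q], in a prescribed set *)

Definition guarded (S w : seq nat) : Prop :=
  forall a c q y, subseq [:: a; c; q; y] w -> (a < q < y)%N -> (y < c)%N -> q \in S.

Lemma guarded_subseq S w w' : subseq w' w -> guarded S w -> guarded S w'.
Proof. by move=> sw gw a c q y s; apply: gw; exact: subseq_trans s sw. Qed.

Lemma subseq_catE (s P Q : seq nat) : subseq s (P ++ Q) ->
  exists s1 s2, [/\ s = s1 ++ s2, subseq s1 P & subseq s2 Q].
Proof.
elim: P s => [|x P IH] s /=; first by exists [::], s; split; rewrite ?sub0seq.
case: s => [|y s]; first by exists [::], [::]; split; rewrite ?sub0seq.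
case: eqP => [->|yx] /IH[s1 [s2 [e h1 h2]]].
  by exists (x :: s1), s2; split=> //=; rewrite ?e ?eqxx.
case: s1 e h1 => [|z s1] e h1; first by exists [::], s2; split.
exists (z :: s1), s2; split=> //=; case: eqP => // zx; case: yx.
by case: e => -> _.
Qed.

(* The only new pattern of the second word in which r does not play 2 has r y as its
   1 4, and there m could already have played 1. *)
Lemma guarded_hop S X m L y r B : (r < y)%N -> all (fun x => m < x)%N (r :: B) ->
  guarded S (X ++ m :: L ++ y :: r :: B) -> guarded (r :: S) (X ++ m :: L ++ r :: y :: B).
Proof.
move=> ry mB g a c q z; have -> t : X ++ m :: L ++ t = (X ++ m :: L) ++ t.
  by rewrite -catA.
move=> /subseq_catE[s1 [s2 [e h1 h2]]] hq hz.
(* Unless the occurrence uses [r] followed directly by [y], its part after [L] already embeds in the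
   old word. *)
have [hs|[s4 [e4 h4]]] : subseq s2 (y :: r :: B) \/
    exists s4, s2 = r :: y :: s4 /\ subseq s4 B.
  case: s2 h2 {e} => [|x s3]; first by left.
  have yrB : subseq (y :: B) (y :: r :: B) by rewrite /= eqxx; exact: subseq_cons.
  rewrite [X in X -> _]/=; case: (x =P r) => [->|xr] h; last first.
    by left; apply: subseq_trans yrB; exact: h.
  case: s3 h => [|u s3] h; first by left; rewrite sub1seq !inE eqxx orbT.
  move: h; rewrite [X in X -> _]/=; case: (u =P y) => [-> h|uy h]; first by right; exists s3.
  left; apply: (@subseq_trans _ (r :: B)); last exact: subseq_cons.
  by rewrite /= eqxx.
- rewrite inE; apply/orP; right; apply: (g a c q z) => //.
  rewrite e (_ : X ++ _ = (X ++ m :: L) ++ y :: r :: B); last by rewrite -catA.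
  exact: cat_subseq.
(* The length of [s1] tells whether [r] plays 1, 4 or 2. As 4 it would have to exceed [y], and as 3
   it would leave no role for [y]. *)
- rewrite e4 in e; case: s1 e h1 => [|u1 [|u2 [|u3 [|u4 s1]]]] //=.
  + case=> ea ec e _; rewrite -e in h4.
    rewrite inE; apply/orP; right; apply: (g m y q z) => //.
    * apply: (@subseq_trans _ (m :: L ++ y :: r :: B)); last exact: suffix_subseq.
      apply: (@cat_subseq _ [:: m] [:: y; q; z] [:: m]) => //.
      apply: (@cat_subseq _ [::] [:: y; q; z] L); first exact: sub0seq.
      apply: (@cat_subseq _ [:: y] [:: q; z] [:: y]) => //.
      exact: (@cat_subseq _ [::] [:: q; z] [:: r]).
    * have : q \in B by apply: (mem_subseq h4); rewrite mem_head.
      by move=> qB; move/allP: mB => /(_ q); rewrite inE qB orbT; lia.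
    * by rewrite -ec.
  + by case=> _ ec eq _; move: hq hz; rewrite ec eq; lia.
  + by case=> _ _ -> _ _; rewrite mem_head.
  + by move=> /(congr1 size); rewrite /= size_cat /=; lia.
Qed.

(** * Total monotonicity from the recursion on the smallest letter *)

Section TotalMonotonicity.
Variable f : seq nat -> Zb.
Hypothesis f_nil : f [::] = 1.
Hypothesis f_min : forall X m R, uniq (X ++ m :: R) ->
  all (fun x => m < x)%N (X ++ R) ->
  f (X ++ m :: R) = hop (fun C => f (X ++ C)) (rev R) [::].

Let tmP n := forall w S, (size w < n)%N -> uniq w -> guarded S w ->
  totally_monotone (fun V => f (filter V w) *+ all V S).

(** The word is restricted to [V] before the hopping starts, so a missing letter takes no part in
    any comparison. *)
Let H X l B (V : pred nat) : Zb :=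
  hop (fun C => f (filter V X ++ C)) (filter V l) (filter V B).

Let G X r l B (V : pred nat) : Zb :=
  hop_gain (fun C => f (filter V X ++ C)) r (filter V l) (filter V B).

(** The size bound omits [m], so that the hypothesis [tmP n] applies to the word without [m];
    guardedness includes [m], which may play 1. *)
Let side n S X m l B :=
  [/\ (size (X ++ rev l ++ B) < n)%N, uniq (X ++ m :: rev l ++ B),
      all (fun x => m < x)%N (X ++ rev l ++ B) & guarded S (X ++ m :: rev l ++ B)].

Let tm_hop n k := forall X m l B S, (size l <= k)%N -> side n S X m l B ->
  totally_monotone (fun V => (H X l B V - f (filter V (X ++ rev l ++ B))) *+ all V S).

Let tm_gain n k := forall X m r l B S, (size l <= k)%N -> side n S X m (r :: l) B ->
  totally_monotone (fun V => G X r l B V *+ all V (r :: S)).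

(** Adds back [f] of the word without [m], which is short enough for [tmP n]. *)
Let tm_hopf n k X m l B S : tmP n -> tm_hop n k -> (size l <= k)%N -> side n S X m l B ->
  totally_monotone (fun V => H X l B V *+ all V S).
Proof.
move=> hP hh hk [h1 h2 h3 h4]; have := tmD (hh X m l B S hk (And4 h1 h2 h3 h4)) (hP _ S h1 _ _).
have sub : subseq (X ++ rev l ++ B) (X ++ m :: rev l ++ B).
  by apply: cat_subseq => //; exact: subseq_cons.
move=> /(_ (subseq_uniq sub h2) (guarded_subseq sub h4)).
by apply: tm_ext => V; rewrite -mulrnDl subrK.
Qed.

(** If [r] is missing from [V], hopping continues with [l] as though [r] were already processed; if
    it is present, [hop_cons] adds the gain. Hence the gain enters with the factor [V r]. *)
Let tm_hopS n k : tm_hop n k -> tm_gain n k -> tm_hop n k.+1.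
Proof.
move=> hh hg X m [|r l] B S /=.
  move=> _ _; apply: tm_ext tm0 => V.
  by rewrite /H /hop /= filter_cat subrr mul0rn.
rewrite ltnS => hk hs; have hs' := hs; case: hs'.
rewrite rev_cons cat_rcons => h1 h2 h3 h4.
apply: tm_ext (tmD (hh X m l (r :: B) S hk (And4 h1 h2 h3 h4)) (hg X m r l B S hk hs)) => V.
rewrite /H /G /=; case: (V r) => /=; last by rewrite mulr0n addr0.
by rewrite -mulrnDl hop_cons addrAC.
Qed.

Let tm_gainS n k : tmP n -> tm_hop n k.+1 -> tm_gain n k -> tm_gain n k.+1.
Proof.
move=> hP hh hg X m r [|y l] B S.
  by move=> _ _; apply: tm_ext tm0 => V; rewrite /G /hop_gain /= mul0rn.
rewrite [size _]/= ltnS => hk [h1 h2 h3 h4].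
have eW : rev [:: r, y & l] ++ B = rev l ++ y :: r :: B by rewrite !rev_cons !cat_rcons.
rewrite eW in h1 h2 h3 h4.
have : uniq (m :: y :: r :: l ++ B ++ X).
  rewrite -(perm_uniq (s1 := X ++ m :: rev l ++ y :: r :: B)) //; apply/seq.permP => P.
  by rewrite /= !count_cat /= !count_cat /= count_rev; lia.
rewrite /= !inE !mem_cat !negb_or => /and4P[_ /and4P[yr yl yB yX] /and3P[rl _ _] _].
have [yr'|ry] := ltnP y r.
  (* Unguarded small letters have only small letters before them. *)
  apply: tm_ext tm0 => V; rewrite /G /=; case Vy: (V y).
    by rewrite /hop_gain yr' mul0rn.
  case: (boolP (y \in S)) => yS.
    suff -> : all V S = false by rewrite andbF.
    by apply/negP => /allP /(_ _ yS); rewrite Vy.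
  rewrite hop_gain0 ?mul0rn // all_filter; apply/allP => c cl; apply/implyP => _.
  rewrite ltnNge; apply: contra yS => rc; apply: (h4 m c y r).
  - apply: (@cat_subseq _ [::] _ X); first exact: sub0seq.
    apply: (@cat_subseq _ [:: m] _ [:: m]) => //.
    apply: (@cat_subseq _ [:: c] [:: y; r]); first by rewrite sub1seq mem_rev.
    apply: (@cat_subseq _ [:: y] _ [:: y]) => //.
    by apply: (@cat_subseq _ [:: r] [::] [:: r]) => //; exact: sub0seq.
  - rewrite yr' andbT; move/allP: h3; apply.
    by rewrite !mem_cat mem_head !orbT.
  - rewrite ltn_neqAle rc andbT; apply: contra rl => /eqP->; exact: cl.
have {}ry : (r < y)%N by rewrite ltn_neqAle eq_sym yr.
have nyr : (y < r)%N = false by apply/negbTE; rewrite -leqNgt ltnW.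
pose W := X ++ m :: rev l ++ r :: y :: B.
have pW : perm_eq W (X ++ m :: rev l ++ y :: r :: B).
  rewrite /W perm_cat2l perm_cons perm_cat2l.
  by apply/seq.permP => P /=; lia.
have s1 : side n S X m (y :: l) (r :: B) by rewrite /side rev_cons cat_rcons.
have s2 : side n (r :: S) X m (r :: l) (y :: B).
  rewrite /side rev_cons cat_rcons; split.
  - by move: h1; rewrite !size_cat /=.
  - by rewrite -/W (perm_uniq pW).
  - move/allP: h3 => h3; apply/allP => x hx; apply: h3; move: hx.
    by rewrite !mem_cat !inE (orbCA (x == r)).
  - apply: guarded_hop h4 => //; apply/allP => x hx; move/allP: h3; apply.
    by rewrite !mem_cat inE hx !orbT.
have t1 := tm_hopf hP hh (hk : size (y :: l) <= k.+1)%N s1.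
have t2 := tm_hopf hP hh (hk : size (r :: l) <= k.+1)%N s2.
have t3 : totally_monotone (fun V => H X l (r :: B) V *+ all V (r :: S)).
  have side3 : side n S X m l (r :: B).
    have sub : subseq (rev l ++ r :: B) (rev l ++ y :: r :: B).
      by apply: cat_subseq => //; exact: subseq_cons.
    have subm : subseq (X ++ m :: rev l ++ r :: B) (X ++ m :: rev l ++ y :: r :: B).
      by apply: cat_subseq => //; apply: (@cat_subseq _ [:: m] _ [:: m]).
    split; first by apply: leq_ltn_trans h1; rewrite !size_cat /=; lia.
    - exact: subseq_uniq subm h2.
    - apply/allP => x hx; move/allP: h3; apply; apply: mem_subseq hx.
      exact: cat_subseq.
    - exact: guarded_subseq subm h4.
  have hk' : (size l <= k.+1)%N by exact: leqW.
  apply: tm_ext (tm_in r (tm_hopf hP hh hk' side3)) => V /=.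
  by rewrite -mulrnA mulnb andbC.
have t4 : totally_monotone (fun V => G X r l B V *+ all V (r :: S)).
  apply: (hg X m r l B S hk).
  have eR : rev (r :: l) ++ B = rev l ++ r :: B by rewrite rev_cons cat_rcons.
  have sub : subseq (rev l ++ r :: B) (rev l ++ y :: r :: B).
    by apply: cat_subseq => //; exact: subseq_cons.
  have subm : subseq (X ++ m :: rev l ++ r :: B) (X ++ m :: rev l ++ y :: r :: B).
    by apply: cat_subseq => //; apply: (@cat_subseq _ [:: m] _ [:: m]).
  rewrite /side eR; split; first by apply: leq_ltn_trans h1; rewrite !size_cat /=; lia.
  - exact: subseq_uniq subm h2.
  - apply/allP => x hx; move/allP: h3; apply; apply: mem_subseq hx.
    exact: cat_subseq.
  - exact: guarded_subseq subm h4.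
have t1' : totally_monotone (fun V => 'X * (H X (y :: l) (r :: B) V *+ all V (r :: S))).
  apply: tmM; first exact: nonneg_polyX.
  by apply: tm_ext (tm_in r t1) => V /=; rewrite -mulrnA mulnb andbC.
have eG (V : pred nat) : V y ->
    G X r (y :: l) B V = 'X * H X (y :: l) (r :: B) V + H X (r :: l) (y :: B) V
     \/ V r = false.
  by move=> Vy; rewrite /G /H /= Vy /hop_gain nyr; case: (V r); [left|right].
(* If [y] is in [S], it belongs to every [V] that counts, and the recursion for the gain applies as
   it stands. *)
case: (boolP (y \in S)) => yS.
  apply: tm_ext (tmD t1' t2) => V; rewrite mulrnAr -mulrnDl -/(all V (r :: S)).
  case: (boolP (all V (r :: S))) => hS; last by rewrite !mulr0n.
  have [//|->|] := eG V; last by move: hS => /= /andP[->].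
    by move: hS => /= /andP[_ /allP]; apply.
  by [].
(* When [y] is missing only the [t4] term remains. When [y] is present, [hop_cons] says that the
   [t2] term with [y] deleted is the sum of the [t3] and [t4] terms with [y] deleted, so everything
   cancels except the [t1'] and [t2] terms at [V]. *)
apply: tm_ext (tmD (tm_pdel y t4) (tm_in y (tmD t1' (tmD (tm_diff y t2) (tm_pdel y t3))))) => V.
have eS : all (pdel V y) (r :: S) = all V (r :: S).
  by rewrite all_pdel inE negb_or yr yS !andbT.
have eX : filter (pdel V y) X = filter V X by exact: filter_pdel.
have el : filter (pdel V y) l = filter V l by exact: filter_pdel.
have eB : filter (pdel V y) B = filter V B by exact: filter_pdel.
have ry' : pdel V y r = V r by rewrite /pdel eq_sym yr andbT.
have yy : pdel V y y = false by rewrite /pdel eqxx andbF.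
rewrite eS /H /G /= eX el eB ry' yy.
case Vy: (V y); last by rewrite mulr0n addr0.
rewrite !mulr1n; case Vr: (V r); last by rewrite !mulr0n mulr0 subrr !addr0.
rewrite /=; case: (all V S); rewrite ?mulr0n ?mulr1n; last by rewrite mulr0 subrr !addr0.
rewrite [X in _ = X]/hop_gain nyr (hop_cons _ r (filter V l) (filter V B)); ring.
Qed.

(** Simultaneous induction: [tm_hop] at [k.+1] comes from both statements at [k], and then serves
    for [tm_gain] at [k.+1]. *)
Let tm_hop_gain n k : tmP n -> tm_hop n k /\ tm_gain n k.
Proof.
move=> hP; have h0 : tm_hop n 0.
  move=> X m [|//] B S _ _; apply: tm_ext tm0 => V.
  by rewrite /H /hop /= filter_cat subrr mul0rn.
have g0 : tm_gain n 0.
  move=> X m r [|//] B S _ _; apply: tm_ext tm0 => V.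
  by rewrite /G /hop_gain /= mul0rn.
elim: k => [|k [hh hg]]; first by [].
have hh' := tm_hopS hh hg.
by split=> //; exact: tm_gainS.
Qed.

Theorem tm_guarded S w : uniq w -> guarded S w ->
  totally_monotone (fun V => f (filter V w) *+ all V S).
Proof.
have [n] := ubnP (size w); elim: n w S => // n IH w S.
rewrite ltnS => hn uw gw.
have hP : tmP n by move=> w' S' hs; exact: IH.
case: (w =P [::]) => [->|/eqP wn].
  by apply: tm_ext (tm_all S tm1) => V; rewrite /= f_nil.
have [X [m [R [eW hmin]]]] := min_split uw wn; subst w.
have sub : subseq (X ++ R) (X ++ m :: R) by apply: cat_subseq => //; exact: subseq_cons.
have hs : side n S X m (rev R) [::].
  rewrite /side revK cats0; split=> //.
  by move: hn; rewrite !size_cat /= addnS.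
have [hh hg] := tm_hop_gain (size (rev R)) hP.
have t1 := hh X m (rev R) [::] S (leqnn _) hs.
have t2 : totally_monotone (fun V => f (filter V (X ++ R)) *+ all V S).
  apply: hP; first by move: hn; rewrite !size_cat /= addnS.
    exact: subseq_uniq uw.
  exact: guarded_subseq gw.
rewrite revK cats0 in t1.
have E (V : pred nat) : V m -> f (filter V (X ++ m :: R)) = H X (rev R) [::] V.
  move=> Vm; rewrite filter_cat /= Vm f_min.
  - by rewrite /H filter_rev.
  - have : uniq (filter V (X ++ m :: R)) by exact: filter_uniq.
    by rewrite filter_cat /= Vm.
  - by rewrite -filter_cat; apply/allP => x; rewrite mem_filter => /andP[_]; move/allP: hmin; apply.
(* The value without [m], plus, if [m] is kept, the excess of hopping over that value. *)
apply: tm_ext (tmD t2 (tm_in m t1)) => V /=.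
case Vm: (V m); first by rewrite -mulrnDl addrC subrK E.
by rewrite addr0 !filter_cat /= Vm.
Qed.

End TotalMonotonicity.

(** * Isobaric divided differences *)

Section Operators.
Variable N : nat.
Local Notation A := {mpoly Zb[N]}.
Local Notation x := (@xv N).
Local Notation b := (betaM N).

Lemma xvE j (h : (j < N)%N) : x j = 'X_(Ordinal h).
Proof. by rewrite /xv insubT. Qed.

Lemma xv_out j : (N <= j)%N -> x j = 0.
Proof. by move=> h; rewrite /xv insubF // ltnNge h. Qed.

Lemma swapvE j (h : (j < N)%N) (h' : (j.+1 < N)%N) (f : A) :
  swapv j f = msym (tperm (Ordinal h) (Ordinal h')) f.
Proof. by rewrite /swapv !insubT. Qed.

Lemma swapv_id j (f : A) : (N <= j.+1)%N -> swapv j f = f.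
Proof.
move=> h; rewrite /swapv; case: insub => // a.
by rewrite insubF // ltnNge h.
Qed.

(** Out of range the permutation is the identity, so the morphism laws below need no bound on
    [j]. *)
Lemma swapv_msym j : exists s : 'S_N, @swapv N j =1 msym s.
Proof.
have [h|h] := leqP N j.+1.
  by exists 1%g => f; rewrite swapv_id // msym1m.
by exists (tperm (Ordinal (ltnW h)) (Ordinal h)) => f; rewrite -swapvE.
Qed.

Lemma swapvM j : {morph @swapv N j : f g / f * g}.
Proof. by move=> f g; case: (swapv_msym j) => s hs; rewrite !hs msymM. Qed.

Lemma swapvD j : {morph @swapv N j : f g / f + g}.
Proof. by move=> f g; case: (swapv_msym j) => s hs; rewrite !hs msymD. Qed.

Lemma swapvB j : {morph @swapv N j : f g / f - g}.
Proof. by move=> f g; case: (swapv_msym j) => s hs; rewrite !hs msymB. Qed.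

Lemma swapv1 j : @swapv N j 1 = 1.
Proof. by case: (swapv_msym j) => s ->; rewrite msym1. Qed.

Lemma swapv0 j : @swapv N j 0 = 0.
Proof. by case: (swapv_msym j) => s ->; rewrite msym0. Qed.

Lemma swapvC j c : @swapv N j c%:MP = c%:MP.
Proof. by case: (swapv_msym j) => s ->; rewrite /msym mmapC. Qed.

Lemma swapvZ j c f : @swapv N j (c *: f) = c *: swapv j f.
Proof. by case: (swapv_msym j) => s hs; rewrite !hs msymZ. Qed.

Lemma swapvK j : involutive (@swapv N j).
Proof.
move=> f; have [h|h] := leqP N j.+1; first by rewrite !swapv_id.
by rewrite !(swapvE (ltnW h) h) -msymMm tperm2 msym1m.
Qed.

Lemma msymXU (s : 'S_N) i : msym s ('X_i : A) = 'X_(s i).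
Proof. by rewrite /msym mmapX mmap1U. Qed.

Lemma swapv_x j k : (j.+1 < N)%N ->
  swapv j (x k) = x (if k == j then j.+1 else if k == j.+1 then j else k).
Proof.
move=> h; have h' := ltnW h.
case: (ltnP k N) => hk; last first.
  have [e1 e2] : k != j /\ k != j.+1 by split; lia.
  by rewrite (negbTE e1) (negbTE e2) xv_out // swapv0.
rewrite (swapvE h' h) (xvE hk) msymXU; case: tpermP.
- by case=> ->; rewrite eqxx (xvE h).
- by case=> ->; rewrite eqn_leq ltnn /= eqxx (xvE h').
- move=> /eqP; rewrite -val_eqE /= => /negbTE-> /eqP; rewrite -val_eqE /= => /negbTE->.
  by rewrite (xvE hk).
Qed.

Lemma swapv_xl j : (j.+1 < N)%N -> swapv j (x j) = x j.+1.
Proof. by move=> h; rewrite swapv_x // eqxx. Qed.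

Lemma swapv_xr j : (j.+1 < N)%N -> swapv j (x j.+1) = x j.
Proof. by move=> h; rewrite swapv_x // eqn_leq ltnn /= eqxx. Qed.

Lemma swapv_xo j k : k != j -> k != j.+1 -> swapv j (x k) = x k.
Proof.
move=> /negbTE h1 /negbTE h2; have [h|h] := leqP N j.+1; first by rewrite swapv_id.
by rewrite swapv_x // h1 h2.
Qed.

Lemma swapv_b j : swapv j b = b.
Proof. exact: swapvC. Qed.

Lemma swapv_comm i j (f : A) : (i.+2 <= j)%N -> swapv i (swapv j f) = swapv j (swapv i f).
Proof.
move=> hij; have [h|h] := leqP N j.+1; first by rewrite !(@swapv_id j).
have hi : (i.+1 < N)%N by lia.
rewrite !(swapvE (ltnW h) h) !(swapvE (ltnW hi) hi) -!msymMm; congr (msym _ _).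
apply/permP => k; rewrite !permM.
do 2!case: tpermP => //; move=> *; subst; do ?case: tpermP => //; move=> *; subst => //;
  repeat match goal with H : Ordinal _ = Ordinal _ |- _ => case: H => *; lia end.
Qed.

Lemma swapv_braid j (f : A) : (j.+2 < N)%N ->
  swapv j (swapv j.+1 (swapv j f)) = swapv j.+1 (swapv j (swapv j.+1 f)).
Proof.
move=> h; have h1 : (j.+1 < N)%N by lia.
have h0 := ltnW h1.
rewrite !(swapvE h0 h1) !(swapvE h1 h) -!msymMm; congr (msym _ _).
set a := Ordinal h0; set c := Ordinal h1; set d := Ordinal h.
have ac : a != c by rewrite -val_eqE /= neq_ltn ltnSn.
have cd : c != d by rewrite -val_eqE /= neq_ltn ltnSn.
have ad : a != d by rewrite -val_eqE /= neq_ltn ltnS leqnSn.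
(* Conjugating one adjacent transposition by the other gives the transposition of the outer
   indices. *)
have e1 : (tperm a c * (tperm c d * tperm a c))%g = tperm a d.
  by rewrite -{1}(tpermV a c) -conjgE tpermJ tpermR tpermD // eq_sym.
have e2 : (tperm c d * (tperm a c * tperm c d))%g = tperm a d.
  by rewrite -{1}(tpermV c d) -conjgE tpermJ tpermL tpermD // eq_sym.
by rewrite e1 e2.
Qed.

Lemma xv_neq i j : (i < N)%N -> i != j -> x i - x j != 0.
Proof.
(* Evaluate at the point with coordinate [i] equal to 1 and all others 0; this also separates [x i]
   from an out-of-range [x j], which is 0. *)
move=> hi ij; apply/eqP => /(congr1 (meval (fun k : 'I_N => (val k == i)%:R))).
rewrite mevalB meval0 (xvE hi) mevalXU /= eqxx.
have [hj|hj] := ltnP j N; last by rewrite xv_out // meval0 subr0 => /eqP; rewrite oner_eq0.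
rewrite (xvE hj) mevalXU /= eq_sym (negbTE ij) subr0 => /eqP; by rewrite oner_eq0.
Qed.

(** Ensures that the [epsilon] in [ddiff] picks a genuine quotient. By the twisted Leibniz rule,
    divisibility passes to products, so the variables suffice. *)
Lemma ddiff_exists j (f : A) : (j.+1 < N)%N ->
  exists g, (x j - x j.+1) * g = f - swapv j f.
Proof.
move=> h; pose P (f : A) := exists g, (x j - x j.+1) * g = f - swapv j f.
have PM f1 f2 : P f1 -> P f2 -> P (f1 * f2).
  move=> [g1 e1] [g2 e2]; exists (g1 * f2 + swapv j f1 * g2).
  by rewrite mulrDr mulrA e1 mulrCA e2 swapvM; ring.
have P1 : P 1 by exists 0; rewrite swapv1 mulr0 subrr.
have PX i : P ('X_i).
  have -> : 'X_i = x i by rewrite (xvE (ltn_ord i)); congr 'X_(_); exact: val_inj.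
  rewrite /P swapv_x //; case: eqP => [->|_]; first by exists 1; rewrite mulr1.
  by case: eqP => [->|_]; [exists (-1); rewrite mulrN1 opprB|exists 0; rewrite mulr0 subrr].
elim/mpolyind: f => [|c m p _ _ [g e]]; first by exists 0; rewrite swapv0 mulr0 subrr.
have [g' e'] : P 'X_[m].
  rewrite mpolyXE_id; elim/big_ind: _ => // i _.
  by elim: (m i) => [|k IH]; rewrite ?expr0 // exprS; exact: PM.
exists (c *: g' + g); rewrite mulrDr -scalerAr e e' swapvD swapvZ scalerBr; ring.
Qed.

(** Denominator-free form of the operator. With [piop_uniq], an identity for [piop] is proved by
    checking this equation for the candidate value. *)
Lemma piopE j (f : A) : (j.+1 < N)%N ->
  (x j - x j.+1) * piop j f = (1 + b * x j.+1) * f - (1 + b * x j) * swapv j f.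
Proof.
move=> h; rewrite /piop /ddiff.
have := ddiff_exists ((1 + b * x j.+1) * f) h.
move=> /(ClassicalEpsilon.epsilon_spec (inhabits 0)) ->.
by rewrite swapvM swapvD swapv1 swapvM swapv_b swapv_xr.
Qed.

Lemma xdiff_inj j (f g : A) : (j.+1 < N)%N ->
  (x j - x j.+1) * f = (x j - x j.+1) * g -> f = g.
Proof.
move=> h; apply: mulfI; apply: xv_neq; first exact: ltnW.
by rewrite neq_ltn ltnSn.
Qed.

Lemma piop_uniq j (f g : A) : (j.+1 < N)%N ->
  (x j - x j.+1) * g = (1 + b * x j.+1) * f - (1 + b * x j) * swapv j f -> g = piop j f.
Proof. by move=> h e; apply: (xdiff_inj h); rewrite e piopE. Qed.

End Operators.

(** * Leibniz, commutation and braid relations for the operators *)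

Section OperatorIdentities.
Variable N : nat.
Local Notation A := {mpoly Zb[N]}.
Local Notation x := (@xv N).
Local Notation b := (betaM N).

Lemma piopD j (f g : A) : (j.+1 < N)%N -> piop j (f + g) = piop j f + piop j g.
Proof.
move=> h; apply/esym/(piop_uniq h); rewrite mulrDr !(piopE _ h) swapvD; ring.
Qed.

Lemma piopM j (e f : A) : (j.+1 < N)%N -> swapv j e = e -> piop j (e * f) = e * piop j f.
Proof.
move=> h he; apply/esym/(piop_uniq h).
by rewrite mulrCA (piopE _ h) swapvM he; ring.
Qed.

Lemma swapv_piop j (f : A) : (j.+1 < N)%N -> swapv j (piop j f) = piop j f.
Proof.
move=> h; apply: (piop_uniq h); have := congr1 (swapv j) (piopE f h).
rewrite !(swapvM, swapvB, swapvD, swapv1, swapv_b, swapvK) swapv_xl // swapv_xr // => e.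
by rewrite -opprB mulNr e; ring.
Qed.

Lemma piop_sym j (f : A) : (j.+1 < N)%N -> swapv j f = f -> piop j f = - b * f.
Proof. by move=> h hf; apply/esym/(piop_uniq h); rewrite hf; ring. Qed.

Lemma piop_piop j (f : A) : (j.+1 < N)%N -> piop j (piop j f) = - b * piop j f.
Proof. by move=> h; rewrite piop_sym ?swapv_piop. Qed.

Lemma piop_x j (f : A) : (j.+1 < N)%N ->
  piop j (x j * f) = (1 + b * x j.+1) * f + x j.+1 * piop j f.
Proof.
move=> h; apply/esym/(piop_uniq h).
by rewrite mulrDr mulrCA [X in _ + X]mulrCA (piopE f h) swapvM swapv_xl //; ring.
Qed.

Lemma piop_x_sym j (f : A) : (j.+1 < N)%N -> swapv j f = f -> piop j (x j * f) = f.
Proof. by move=> h hf; rewrite piop_x // piop_sym //; ring. Qed.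

Lemma swapv_piop_comm i j (f : A) : (i.+1 < N)%N -> (i.+2 <= j)%N || (j.+2 <= i)%N ->
  swapv j (piop i f) = piop i (swapv j f).
Proof.
move=> h hij; have e1 : swapv j (x i) = x i by rewrite swapv_xo //; lia.
have e2 : swapv j (x i.+1) = x i.+1 by rewrite swapv_xo //; lia.
apply: (piop_uniq h); have := congr1 (swapv j) (piopE f h).
rewrite !(swapvM, swapvB, swapvD, swapv1, swapv_b) e1 e2 => ->.
case/orP: hij => hij; first by rewrite (swapv_comm _ hij).
by rewrite (swapv_comm _ hij).
Qed.

(** The coefficients in the equation defining [piop i] are fixed by [swapv j], so [piop j] can be
    applied to that equation term by term. *)
Lemma piop_comm i j (f : A) : (i.+1 < N)%N -> (j.+1 < N)%N ->
  (i.+2 <= j)%N || (j.+2 <= i)%N -> piop i (piop j f) = piop j (piop i f).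
Proof.
move=> hi hj hij; apply/esym/(piop_uniq hi).
have hji : (j.+2 <= i)%N || (i.+2 <= j)%N by rewrite orbC.
have e1 : swapv j (x i) = x i by rewrite swapv_xo //; lia.
have e2 : swapv j (x i.+1) = x i.+1 by rewrite swapv_xo //; lia.
have e3 : swapv j (x i - x i.+1) = x i - x i.+1 by rewrite swapvB e1 e2.
have e4 : swapv j (1 + b * x i.+1) = 1 + b * x i.+1.
  by rewrite !(swapvM, swapvD, swapv1, swapv_b) e2.
have e5 : swapv j (- (1 + b * x i)) = - (1 + b * x i).
  by rewrite -sub0r swapvB swapv0 !(swapvM, swapvD, swapv1, swapv_b) e1.
rewrite (swapv_piop_comm f hj hji) -(piopM _ hj e3) -(piopM _ hj e4) -mulNr.
by rewrite -(piopM _ hj e5) -piopD // (piopE f hi) mulNr.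
Qed.

(* Both sides of the braid relation are the same antisymmetrised sum over S_3, divided
   by the Vandermonde product. *)
Lemma braid_algebra (R : idomainType) (b X Y Z f f1 f2 f12 f21 f121 : R)
    (g h k g' h' k' sg ssg sh sg' ssg' sh' : R) :
  X - Y != 0 -> Y - Z != 0 -> X - Z != 0 ->
  (X - Y) * g = (1 + b * Y) * f - (1 + b * X) * f1 ->
  (X - Z) * sg = (1 + b * Z) * f2 - (1 + b * X) * f21 ->
  (Y - Z) * h = (1 + b * Z) * g - (1 + b * Y) * sg ->
  (X - Z) * sh = (1 + b * Z) * g - (1 + b * X) * ssg ->
  (Y - Z) * ssg = (1 + b * Z) * f12 - (1 + b * Y) * f121 ->
  (X - Y) * k = (1 + b * Y) * h - (1 + b * X) * sh ->
  (Y - Z) * g' = (1 + b * Z) * f - (1 + b * Y) * f2 ->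
  (X - Z) * sg' = (1 + b * Z) * f1 - (1 + b * X) * f12 ->
  (X - Y) * h' = (1 + b * Y) * g' - (1 + b * X) * sg' ->
  (X - Z) * sh' = (1 + b * Z) * g' - (1 + b * X) * ssg' ->
  (X - Y) * ssg' = (1 + b * Y) * f21 - (1 + b * X) * f121 ->
  (Y - Z) * k' = (1 + b * Z) * h' - (1 + b * Y) * sh' ->
  k = k'.
Proof.
move=> nz1 nz2 nz3 E1 E2 E3 E4 E5 E6 F1 F2 F3 F4 F5 F6.
pose D := (X - Y) * (X - Z) * (Y - Z).
pose P := (1 + b * Y) * (1 + b * Z) ^+ 2 * f - (1 + b * X) * (1 + b * Z) ^+ 2 * f1
  - (1 + b * Y) ^+ 2 * (1 + b * Z) * f2 + (1 + b * X) * (1 + b * Y) ^+ 2 * f21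
  + (1 + b * X) ^+ 2 * (1 + b * Z) * f12 - (1 + b * X) ^+ 2 * (1 + b * Y) * f121.
have nzD : D != 0 by rewrite !mulf_neq0.
have hk : (X - Y) * (D * k) = (X - Y) * P.
  rewrite mulrCA E6 mulrBr.
  have -> : D * ((1 + b * Y) * h) = (X - Y) * (X - Z) * (1 + b * Y) * ((Y - Z) * h).
    by rewrite /D; ring.
  have -> : D * ((1 + b * X) * sh) = (X - Y) * (Y - Z) * (1 + b * X) * ((X - Z) * sh).
    by rewrite /D; ring.
  rewrite E3 E4.
  transitivity (((1 + b * Y) * (1 + b * Z) * (X - Z) - (1 + b * X) * (1 + b * Z) * (Y - Z))
      * ((X - Y) * g) - (1 + b * Y) ^+ 2 * (X - Y) * ((X - Z) * sg)
      + (1 + b * X) ^+ 2 * (X - Y) * ((Y - Z) * ssg)); first by ring.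
  by rewrite E1 E2 E5 /P; ring.
have hk' : (Y - Z) * (D * k') = (Y - Z) * P.
  rewrite mulrCA F6 mulrBr.
  have -> : D * ((1 + b * Z) * h') = (Y - Z) * (X - Z) * (1 + b * Z) * ((X - Y) * h').
    by rewrite /D; ring.
  have -> : D * ((1 + b * Y) * sh') = (X - Y) * (Y - Z) * (1 + b * Y) * ((X - Z) * sh').
    by rewrite /D; ring.
  rewrite F3 F4.
  transitivity (((1 + b * Y) * (1 + b * Z) * (X - Z) - (1 + b * Y) * (1 + b * Z) * (X - Y))
      * ((Y - Z) * g') - (1 + b * Z) * (1 + b * X) * (Y - Z) * ((X - Z) * sg')
      + (1 + b * Y) * (1 + b * X) * (Y - Z) * ((X - Y) * ssg')); first by ring.
  by rewrite F1 F2 F5 /P; ring.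
apply: (mulfI nzD); rewrite (mulfI nz1 hk); exact/esym/(mulfI nz2 hk').
Qed.

(** Images of the defining equation under swaps supply the equations for the auxiliary unknowns of
    [braid_algebra]. *)
Lemma swapv_piopE i j (f : A) : (j.+1 < N)%N ->
  (swapv i (x j) - swapv i (x j.+1)) * swapv i (piop j f) =
  (1 + b * swapv i (x j.+1)) * swapv i f - (1 + b * swapv i (x j)) * swapv i (swapv j f).
Proof.
move=> h; have := congr1 (swapv i) (piopE f h).
by rewrite !(swapvM, swapvB, swapvD, swapv1, swapv_b).
Qed.

Lemma swapv2_piopE k i j (f : A) : (j.+1 < N)%N ->
  (swapv k (swapv i (x j)) - swapv k (swapv i (x j.+1))) * swapv k (swapv i (piop j f)) =
  (1 + b * swapv k (swapv i (x j.+1))) * swapv k (swapv i f)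
  - (1 + b * swapv k (swapv i (x j))) * swapv k (swapv i (swapv j f)).
Proof.
move=> h; have := congr1 (swapv k) (swapv_piopE i f h).
by rewrite !(swapvM, swapvB, swapvD, swapv1, swapv_b).
Qed.

Lemma piop_braid j (f : A) : (j.+2 < N)%N ->
  piop j (piop j.+1 (piop j f)) = piop j.+1 (piop j (piop j.+1 f)).
Proof.
move=> h2; have h1 : (j.+1 < N)%N by lia.
have s0X : swapv j (x j) = x j.+1 by exact: swapv_xl.
have s0Y : swapv j (x j.+1) = x j by exact: swapv_xr.
have s0Z : swapv j (x j.+2) = x j.+2 by apply: swapv_xo; lia.
have s1X : swapv j.+1 (x j) = x j by apply: swapv_xo; lia.
have s1Y : swapv j.+1 (x j.+1) = x j.+2 by exact: swapv_xl.
have s1Z : swapv j.+1 (x j.+2) = x j.+1 by exact: swapv_xr.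
have nz1 : x j - x j.+1 != 0 by apply: xv_neq; lia.
have nz2 : x j.+1 - x j.+2 != 0 by apply: xv_neq; lia.
have nz3 : x j - x j.+2 != 0 by apply: xv_neq; lia.
have E2 := swapv_piopE j.+1 f h1; rewrite s1X s1Y in E2.
have E4 := swapv_piopE j (piop j f) h2; rewrite s0Y s0Z (swapv_piop f h1) in E4.
have E5 := swapv2_piopE j j.+1 f h1; rewrite s1X s1Y s0X s0Z in E5.
have F2 := swapv_piopE j f h2; rewrite s0Y s0Z in F2.
have F4 := swapv_piopE j.+1 (piop j.+1 f) h1; rewrite s1X s1Y (swapv_piop f h2) in F4.
have F5 := swapv2_piopE j.+1 j f h2; rewrite s0Y s0Z s1X s1Z -(swapv_braid f h2) in F5.
exact: (braid_algebra nz1 nz2 nz3 (piopE f h1) E2 (piopE _ h2) E4 E5 (piopE _ h1)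
  (piopE f h2) F2 (piopE _ h1) F4 F5 (piopE _ h2)).
Qed.

End OperatorIdentities.

(** * Grothendieck polynomials of words *)

Lemma first_ascent_cons x y w :
  first_ascent [:: x, y & w] =
  if (x < y)%N then Some 0%N else omap S (first_ascent (y :: w)).
Proof.
rewrite /first_ascent /=; case: (x < y)%N => //=.
rewrite -(addn0 1%N) iotaDl find_map /=.
rewrite (eq_find (a2 := fun k => nth 0%N (y :: w) k < nth 0%N w k)%N) //.
by rewrite ltnS; case: ifP.
Qed.

Lemma first_ascent_none w : sorted geq w -> first_ascent w = None.
Proof.
elim: w => [|x [|y w] IH] //= /andP[xy h].
by rewrite first_ascent_cons ltnNge xy /= IH.
Qed.

Lemma first_ascent_some P a c Q : sorted geq (rcons P a) -> (a < c)%N ->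
  first_ascent (P ++ a :: c :: Q) = Some (size P).
Proof.
elim: P => [|x P IH] /= h ac; first by rewrite first_ascent_cons ac.
case: P IH h => [|y P] /= IH /andP[xy h].
  by rewrite first_ascent_cons ltnNge xy /= IH.
by rewrite first_ascent_cons ltnNge xy /= IH.
Qed.

Lemma swap_pos_cat P a c Q : swap_pos (size P) (P ++ a :: c :: Q) = P ++ c :: a :: Q.
Proof.
rewrite /swap_pos !nth_cat ltnn subnn /= ltnNge leqnSn /= subSnn /=.
by elim: P => //= x P ->.
Qed.

Lemma ascent_split w : sorted geq w \/ exists P a c Q,
  [/\ w = P ++ a :: c :: Q, sorted geq (rcons P a) & (a < c)%N].
Proof.
elim: w => [|x [|y w] IH]; [by left|by left|].
have [xy|yx] := ltnP x y; first by right; exists [::], x, y, w.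
case: IH => [h|[P [a [c [Q [e h ac]]]]]]; first by left; rewrite /= yx.
right; exists (x :: P), a, c, Q; split=> //; first by rewrite e.
by case: P e h => [|z P] /= [<- _] h; rewrite yx.
Qed.

(** Each exchange at an ascent lowers this number by one, so it counts the steps to the decreasing
    word and bounds the fuel required. *)
Fixpoint noninv (w : seq nat) : nat :=
  if w is x :: w' then (count (fun y => x < y) w' + noninv w')%N else 0%N.

Lemma noninv_swap P a c Q : (a < c)%N ->
  noninv (P ++ a :: c :: Q) = (noninv (P ++ c :: a :: Q)).+1.
Proof.
move=> ac; elim: P => [|x P IH] /=; last by rewrite IH !count_cat /=; lia.
by rewrite ac ltnNge (ltnW ac) /=; lia.
Qed.

Lemma noninv_le w : (noninv w <= size w ^ 2)%N.
Proof.
elim: w => //= x w IH; have := count_size (fun y => x < y)%N w; lia.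
Qed.

Section Grothendieck.
Variable N : nat.
Local Notation A := {mpoly Zb[N]}.
Local Notation x := (@xv N).
Local Notation b := (betaM N).

(** Generalizes [groth_fuel] to an arbitrary starting polynomial [tau], so that words of different
    lengths can be compared in the same ring. *)
Fixpoint groth_from_fuel (tau : A) (k : nat) (w : seq nat) : A :=
  if k is k'.+1 then
    if first_ascent w is Some j then piop j (groth_from_fuel tau k' (swap_pos j w)) else tau
  else 0.

Definition groth_from (tau : A) (w : seq nat) : A := groth_from_fuel tau (size w ^ 2).+1 w.

Lemma groth_from_fuel_enough tau k k' w : (noninv w < k)%N -> (noninv w < k')%N ->
  groth_from_fuel tau k w = groth_from_fuel tau k' w.
Proof.
elim: k k' w => // k IH [|k'] w //.
case: (ascent_split w) => [h|[P [a [c [Q [-> h ac]]]]]].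
  by rewrite /= first_ascent_none.
rewrite (noninv_swap _ _ ac) !ltnS => h1 h2.
by rewrite /= first_ascent_some // swap_pos_cat (IH k').
Qed.

Lemma groth_from_sorted tau w : sorted geq w -> groth_from tau w = tau.
Proof. by move=> h; rewrite /groth_from /= first_ascent_none. Qed.

Lemma groth_from_ascent tau P a c Q : sorted geq (rcons P a) -> (a < c)%N ->
  groth_from tau (P ++ a :: c :: Q) = piop (size P) (groth_from tau (P ++ c :: a :: Q)).
Proof.
move=> h ac; rewrite {1}/groth_from /= first_ascent_some // swap_pos_cat.
congr (piop _ _); apply: groth_from_fuel_enough; last by rewrite ltnS noninv_le.
by have := noninv_le (P ++ a :: c :: Q); rewrite (noninv_swap _ _ ac).
Qed.

Fixpoint piops (p k : nat) (h : A) : A :=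
  if k is k'.+1 then piop p (piops p.+1 k' h) else h.

Lemma piopsS p k h : piops p k.+1 h = piops p k (piop (p + k) h).
Proof.
elim: k p => [|k IH] p; first by rewrite /= addn0.
by rewrite [LHS]/= -/(piops p.+1 k.+1 h) IH addSnnS.
Qed.

Lemma piopsD p k f g : (p + k < N)%N -> piops p k (f + g) = piops p k f + piops p k g.
Proof. by elim: k p => //= k IH p h; rewrite IH ?piopD //; lia. Qed.

Lemma piop_piops_comm i p k h : (i.+2 <= p)%N -> (p + k < N)%N -> (i.+1 < N)%N ->
  piop i (piops p k h) = piops p k (piop i h).
Proof.
elim: k p => //= k IH p hip hpk hi.
by rewrite piop_comm ?IH ?hip //; lia.
Qed.

Lemma swapv_piops i p k h : (p + k < N)%N -> (p + k < i)%N ->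
  swapv i (piops p k h) = piops p k (swapv i h).
Proof.
elim: k p => //= k IH p hpk hi.
by rewrite swapv_piop_comm ?IH //; lia.
Qed.

(** The operator commutes with the product until it meets the factors of index [i] and [i.+1]; the
    braid relation then lowers its index, and it commutes with the rest. *)
Lemma piop_piops_braid i p k h : (p <= i)%N -> (i.+1 < p + k)%N -> (p + k < N)%N ->
  piop i.+1 (piops p k h) = piops p k (piop i h).
Proof.
elim: k p => [|k IH] p hp hik hN; first by lia.
have [epi|npi] := eqVneq i p.
  case: k IH hik hN => [|k] _ hik hN; first by lia.
  rewrite epi /= -piop_braid; last by lia.
  by rewrite piop_piops_comm //; lia.
rewrite /= piop_comm; [|lia|lia|lia].
by rewrite IH //; lia.
Qed.

(** Follows the descent along first ascents. An ascent inside [X] comes first, and its operator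
    commutes with the product; once [X] is decreasing, [m] passes its right neighbour, which
    produces the leftmost factor. *)
Lemma groth_from_min tau X m R : (size (X ++ m :: R) <= N)%N ->
  all (fun y => m < y)%N (X ++ R) ->
  groth_from tau (X ++ m :: R) = piops (size X) (size R) (groth_from tau (X ++ R)).
Proof.
have [n] := ubnP (noninv (X ++ m :: R)); elim: n X R => // n IH X R hn hN hm.
case: (ascent_split X) => [sX|[P [a [c [Q [eX sP ac]]]]]].
  have sXm : sorted geq (rcons X m).
    case: X sX hm {IH hn hN} => //= y X; rewrite rcons_path => -> /andP[my hm] /=.
    have := mem_last y X; rewrite inE => /orP[/eqP->|hl]; first exact: ltnW.
    by move/allP: hm => /(_ (last y X)); rewrite mem_cat hl => /(_ isT) /ltnW.
  case: R hn hN hm => [|c R] hn hN hm.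
    by rewrite cats0 /= !groth_from_sorted // cats1.
  have mc : (m < c)%N by move: hm; rewrite all_cat /= => /and3P[].
  rewrite groth_from_ascent // -cat_rcons IH.
  - by rewrite size_rcons /= cat_rcons.
  - by move: hn; rewrite (noninv_swap _ _ mc) ltnS cat_rcons.
  - by move: hN; rewrite !size_cat size_rcons /=; lia.
  - by rewrite cat_rcons.
have e1 : X ++ m :: R = P ++ a :: c :: Q ++ m :: R by rewrite eX -catA.
have e2 : X ++ R = P ++ a :: c :: Q ++ R by rewrite eX -catA.
have eS : size X = size (P ++ c :: a :: Q) by rewrite eX !size_cat.
have hsX : (size X = size P + (size Q).+2)%N by rewrite eX size_cat.
have hN' : (size X + size R < N)%N by move: hN; rewrite size_cat /=; lia.
rewrite e1 (groth_from_ascent _ _ sP ac) e2 (groth_from_ascent _ _ sP ac).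
rewrite -(@piop_piops_comm (size P) (size X) (size R)); [|lia|lia|lia].
congr (piop _ _).
have := IH (P ++ c :: a :: Q) R; rewrite -eS -!catA !cat_cons; apply.
- by move: hn; rewrite e1 (noninv_swap _ _ ac).
- by move: hN; rewrite e1 !size_cat /= !size_cat.
- move: hm; rewrite e2 !all_cat /= !all_cat => /and5P[h1 h2 h3 h4 h5].
  by rewrite h1 h2 h3 h4.
Qed.

(** Any ascent, not only the first, may be used to compute the polynomial. The proof removes the
    smallest letter by [groth_from_min]. *)
Lemma piop_groth_from_descent tau P a c Q : uniq (P ++ a :: c :: Q) ->
  (size (P ++ a :: c :: Q) <= N)%N -> (c < a)%N ->
  piop (size P) (groth_from tau (P ++ a :: c :: Q)) = groth_from tau (P ++ c :: a :: Q).
Proof.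
have [n] := ubnP (size (P ++ a :: c :: Q)); elim: n P Q => // n IH P Q hn uw hN ca.
have [|m mw hm] := @min_exists (P ++ a :: c :: Q); first by case: (P).
have pW : perm_eq (P ++ c :: a :: Q) (P ++ a :: c :: Q).
  by rewrite perm_cat2l; apply/seq.permP => p /=; lia.
have uw' : uniq (P ++ c :: a :: Q) by rewrite (perm_uniq pW).
have hm' y : y \in P ++ c :: a :: Q -> (m <= y)%N by rewrite (perm_mem pW); exact: hm.
have hN' : (size (P ++ c :: a :: Q) <= N)%N by rewrite (perm_size pW).
(* If [m] is left of the pair, the braid relation absorbs the index shift; [m = a] is excluded by
   [c < a]; for [m = c] the two products differ by exactly this operator; if [m] is to the right,
   the operators commute. *)
move: mw; rewrite mem_cat !inE => /or4P[mP|/eqP ma|/eqP mc|mQ].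
- case/splitPr: mP uw uw' hN hN' hn hm hm' {pW} => P1 P2.
  rewrite -!catA !cat_cons => uw uw' hN hN' hn hm hm'.
  have sub y : subseq (P1 ++ P2 ++ y) (P1 ++ m :: P2 ++ y).
    by apply: cat_subseq => //; exact: subseq_cons.
  have hs1 : (size (P1 ++ m :: P2 ++ a :: c :: Q) = (size P1 + size P2 + size Q).+3)%N.
    by rewrite !size_cat /= size_cat /=; lia.
  have hN2 := hN; rewrite hs1 in hN2.
  rewrite !groth_from_min ?min_all // size_cat /= addnS.
  have hsz y z : size (P2 ++ y :: z :: Q) = (size P2 + size Q).+2 by rewrite size_cat /= !addnS.
  rewrite !hsz piop_piops_braid; first last.
  + by rewrite !addnS addnA.
  + by rewrite !addnS addnA !ltnS leq_addr.
  + by rewrite leq_addr.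
  congr (piops _ _ _); rewrite -size_cat !(catA P1 P2); apply: IH => //.
  + by rewrite -catA; rewrite !size_cat /= in hs1 hn *; lia.
  + by rewrite -catA; exact: subseq_uniq (sub _) uw.
  + by rewrite -catA; rewrite !size_cat /= in hs1 hN *; lia.
- by have := hm c; rewrite ma mem_cat !inE eqxx !orbT => /(_ isT); lia.
- subst m; rewrite (groth_from_min tau hN' (min_all uw' hm')) -cat_rcons in uw hN hm *.
  rewrite (groth_from_min tau hN (min_all uw hm)) size_rcons cat_rcons.
  by [].
- case/splitPr: mQ uw uw' hN hN' hn hm hm' {pW} => Q1 Q2 uw uw' hN hN' hn hm hm'.
  have eP (a' c' : nat) Q' : P ++ a' :: c' :: Q1 ++ Q' = (P ++ a' :: c' :: Q1) ++ Q'.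
    by rewrite -catA.
  rewrite (eP a c) in uw hN hm *; rewrite (eP c a) in uw' hN' hm' *.
  rewrite !groth_from_min ?min_all // piop_piops_comm.
  + have -> : size (P ++ a :: c :: Q1) = size (P ++ c :: a :: Q1) by rewrite !size_cat.
    congr (piops _ _ _); rewrite -!eP; apply: IH => //.
    * by move: hn; rewrite !size_cat /= ?size_cat /=; lia.
    * rewrite eP; apply: subseq_uniq uw; apply: cat_subseq => //; exact: subseq_cons.
    * by move: hN; rewrite !size_cat /= ?size_cat /=; lia.
  + by rewrite size_cat /=; lia.
  + by move: hN; rewrite !size_cat /= ?size_cat /=; lia.
  + by move: hN; rewrite !size_cat /= ?size_cat /=; lia.
Qed.

Lemma piop_groth_from_ascent tau P a c Q : uniq (P ++ a :: c :: Q) ->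
  (size (P ++ a :: c :: Q) <= N)%N -> (a < c)%N ->
  piop (size P) (groth_from tau (P ++ a :: c :: Q)) = - b * groth_from tau (P ++ a :: c :: Q).
Proof.
move=> uw hN ac.
have pW : perm_eq (P ++ c :: a :: Q) (P ++ a :: c :: Q).
  by rewrite perm_cat2l; apply/seq.permP => p /=; lia.
rewrite -piop_groth_from_descent ?(perm_uniq pW) ?(perm_size pW) //.
by rewrite piop_piop //; move: hN; rewrite size_cat /=; lia.
Qed.

End Grothendieck.

(* Symmetry and evaluation at ones *)
Opaque groth_from piop swapv xv.

Section Specialization.
Variable N : nat.
Local Notation A := {mpoly Zb[N]}.
Local Notation x := (@xv N).
Local Notation b := (betaM N).

(** A factor symmetric under all swaps that the word can use passes through every operator; this
    detaches [xprod] from the staircase monomial. *)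
Lemma groth_from_mul e tau w : (size w <= N)%N ->
  (forall j, (j.+1 < size w)%N -> swapv j e = e) ->
  groth_from (e * tau) w = e * @groth_from N tau w.
Proof.
have [n] := ubnP (noninv w); elim: n w => // n IH w hn hN he.
case: (ascent_split w) => [h|[P [a [c [Q [ew h ac]]]]]]; first by rewrite !groth_from_sorted.
have hs : size w = (size P + (size Q).+2)%N by rewrite ew size_cat.
have hs' : size (P ++ c :: a :: Q) = size w by rewrite ew !size_cat.
rewrite ew (groth_from_ascent _ _ h ac) (groth_from_ascent tau _ h ac) IH ?hs' //; last first.
  by move: hn; rewrite ew (noninv_swap _ _ ac).
by rewrite piopM // ?he //; lia.
Qed.

Lemma groth_from_mono tau (h : nat -> nat) w : {in w &, {mono h : y z / (y < z)%N}} ->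
  @groth_from N tau (map h w) = groth_from tau w.
Proof.
have [n] := ubnP (noninv w); elim: n w => // n IH w hn hm.
case: (ascent_split w) => [sw|[P [a [c [Q [ew sP ac]]]]]].
  rewrite !groth_from_sorted // sorted_map; apply: (sub_in_sorted _ (allss w) sw) => y z yw zw /=.
  by rewrite /geq /= leqNgt => yz; rewrite leqNgt hm.
have aw : a \in w by rewrite ew mem_cat mem_head orbT.
have cw : c \in w by rewrite ew mem_cat !inE eqxx !orbT.
have pW : perm_eq (P ++ c :: a :: Q) w.
  by rewrite ew perm_cat2l; apply/seq.permP => p /=; lia.
have sP' : sorted geq (rcons (map h P) (h a)).
  rewrite -map_rcons sorted_map; apply: (sub_in_sorted _ (allss _) sP) => y z yw zw /=.
  have sub t : t \in rcons P a -> t \in w.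
    by rewrite ew -cat_rcons mem_cat => ->.
  by rewrite /geq /= leqNgt => yz; rewrite leqNgt hm ?sub.
have hac : (h a < h c)%N by rewrite hm.
rewrite ew map_cat /= (groth_from_ascent _ _ sP' hac) (groth_from_ascent _ _ sP ac).
rewrite size_map; congr (piop _ _).
have := IH (P ++ c :: a :: Q); rewrite map_cat; apply.
  by move: hn; rewrite ew (noninv_swap _ _ ac).
by move=> y z; rewrite !(perm_mem pW); exact: hm.
Qed.

Definition xprod (M : nat) : A := \prod_(0 <= i < M) x i.

(** The starting monomial for words of length [M], with [M] independent of the number of
    variables. *)
Definition stair (M : nat) : A := \prod_(0 <= i < M) x i ^+ (M.-1 - i).

Lemma stairS M : stair M.+1 = xprod M * stair M.
Proof.
rewrite /stair /xprod big_nat_recr //= subnn expr0 mulr1 -big_split.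
by apply: eq_big_nat => i hi; rewrite /= -exprS; congr (_ ^+ _); lia.
Qed.

Lemma topmon_stair : topmon N = stair N.
Proof.
rewrite /topmon /stair big_mkord; apply: eq_bigr => i _.
by rewrite (xvE (ltn_ord i)); congr ('X_(_) ^+ _); exact: val_inj.
Qed.

Lemma xprodS M : xprod M.+1 = xprod M * x M.
Proof. by rewrite /xprod big_nat_recr. Qed.

Lemma swapv_xprod_ge j M : (M <= j)%N -> swapv j (xprod M) = xprod M.
Proof.
elim: M => [|M IH] h; first by rewrite /xprod big_geq // swapv1.
by rewrite xprodS swapvM IH ?swapv_xo //; lia.
Qed.

Lemma swapv_xprod_lt j M : (j.+1 < N)%N -> (j.+1 < M)%N -> swapv j (xprod M) = xprod M.
Proof.
move=> hj; elim: M => // M IH; rewrite ltnS leq_eqVlt => /orP[/eqP <-|h]; last first.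
  by rewrite xprodS swapvM IH ?swapv_xo //; lia.
rewrite !xprodS !swapvM swapv_xprod_ge // swapv_xl // swapv_xr //.
by rewrite mulrAC.
Qed.

(* The Grothendieck polynomial of a word of size M only involves the first M - 1 variables. *)
Lemma groth_from_stair_sym (w : seq nat) j : uniq w -> (size w <= N)%N -> ((size w).-1 <= j)%N ->
  swapv j (groth_from (stair (size w)) w) = groth_from (stair (size w)) w.
Proof.
have [n] := ubnP (size w); elim: n w j => // n IH w j hn uw hN hj.
case: (w =P [::]) => [->|/eqP wn].
  by rewrite groth_from_sorted // /stair big_geq // swapv1.
have [X [m [R [ew hm]]]] := min_split uw wn; subst w.
have sub : subseq (X ++ R) (X ++ m :: R) by apply: cat_subseq => //; exact: subseq_cons.
have uXR := subseq_uniq sub uw.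
have hs : size (X ++ m :: R) = (size (X ++ R)).+1 by rewrite !size_cat addnS.
have hsXR : size (X ++ R) = (size X + size R)%N by rewrite size_cat.
have [hN1|hN1] := leqP N j.+1; first by rewrite swapv_id.
have {}IH i : ((size (X ++ R)).-1 <= i)%N ->
    swapv i (groth_from (stair (size (X ++ R))) (X ++ R)) =
      groth_from (stair (size (X ++ R))) (X ++ R).
  by move=> hi; apply: IH => //; lia.
rewrite groth_from_min // hs stairS groth_from_mul; first last.
- by move=> i hi; apply: swapv_xprod_lt => //; lia.
- by lia.
have hj' : (size X + size R <= j)%N by lia.
have hN' : (size X + size R < N)%N by lia.
rewrite !hsXR in IH *.
case: (size R) IH hj' hN' => [|k] IH hj' hN'.
  by rewrite /= swapvM swapv_xprod_ge ?IH //; lia.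
rewrite piopsS addnS xprodS -mulrA piopM; first last.
- by apply: swapv_xprod_ge; lia.
- by lia.
rewrite addnS in IH.
(* The innermost operator removes the last variable of [xprod], because the remaining polynomial is
   symmetric there. *)
rewrite piop_x_sym; [|lia|by apply: IH; lia].
rewrite swapv_piops; [|lia|lia].
by rewrite swapvM swapv_xprod_ge ?IH //; lia.
Qed.

Definition ev1 (f : A) : Zb := f.@[fun=> 1].

Lemma ev1M f g : ev1 (f * g) = ev1 f * ev1 g.
Proof. exact: mevalM. Qed.

Lemma ev1D f g : ev1 (f + g) = ev1 f + ev1 g.
Proof. exact: mevalD. Qed.

Lemma ev1_1 : ev1 1 = 1.
Proof. exact: meval1. Qed.

Lemma ev1_x j : (j < N)%N -> ev1 (x j) = 1.
Proof. by move=> h; rewrite (xvE h) /ev1 mevalXU. Qed.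

Lemma ev1_b : ev1 b = 'X.
Proof. exact: mevalC. Qed.

Lemma ev1_xprod M : (M <= N)%N -> ev1 (xprod M) = 1.
Proof.
elim: M => [|M IH] h; first by rewrite /xprod big_geq // ev1_1.
by rewrite xprodS ev1M IH ?ev1_x ?mulr1 //; lia.
Qed.

(** The factor [c] collects what the Leibniz rule leaves behind. These factors lie beyond the reach
    of the remaining operators, and at ones they become [1 + 'X] or 1. *)
Lemma ev1_piops tau (X : seq nat) (r : nat) (l B : seq nat) c :
  uniq (X ++ rev l ++ r :: B) -> (size (X ++ rev l ++ r :: B) < N)%N ->
  (forall i, (i < size X + size l)%N -> swapv i c = c) ->
  ev1 (piops (size X) (size l)
         (xprod (size X + size l) * (c * groth_from tau (X ++ rev l ++ r :: B)))) =
  ev1 c * hopr (fun C => ev1 (groth_from tau (X ++ C))) r l B.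
Proof.
elim: l r B c => [|y l IH] r B c /=.
  move=> _ hN _; rewrite addn0 !ev1M ev1_xprod ?mul1r //.
  by move: hN; rewrite size_cat /=; lia.
rewrite rev_cons cat_rcons => uw hN hc.
have pW : perm_eq (X ++ rev l ++ r :: y :: B) (X ++ rev l ++ y :: r :: B).
  by rewrite !perm_cat2l; apply/seq.permP => p /=; lia.
have uw' : uniq (X ++ rev l ++ r :: y :: B) by rewrite (perm_uniq pW).
have hN' : (size (X ++ rev l ++ r :: y :: B) < N)%N by rewrite (perm_size pW).
have hs : size (X ++ rev l ++ y :: r :: B) = (size X + size l + (size B).+2)%N.
  by rewrite !size_cat size_rev /= addnA.
have hsX : size (X ++ rev l) = (size X + size l)%N by rewrite size_cat size_rev.
set i := (size X + size l)%N.
rewrite -/(piops _ (size l).+1 _) piopsS addnS xprodS -/i -mulrA (mulrCA (x i)).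
rewrite piopM; [|lia|by apply: swapv_xprod_ge].
rewrite piopM; [|lia|by apply: hc; lia].
rewrite piop_x; last by lia.
have yr : y != r.
  have : uniq (y :: r :: X ++ rev l ++ B).
    rewrite -(perm_uniq (s1 := X ++ rev l ++ y :: r :: B)) //; apply/seq.permP => p.
    by rewrite /= !count_cat /=; lia.
  by rewrite /= inE negb_or => /andP[/andP[]].
have hcx k : (k < size X + size l)%N -> swapv k (x i.+1) = x i.+1.
  by move=> hk; rewrite swapv_xo //; lia.
have hx : ev1 (x i.+1) = 1 by apply: ev1_x; lia.
have [yr'|ry] := ltnP y r.
  have := @piop_groth_from_ascent N tau (X ++ rev l) y r B.
  rewrite -catA hsX -/i => /(_ uw (ltnW hN) yr') ->.
  set g := groth_from tau _.
  (* At an ascent the two Leibniz terms collapse to [g]: no hop, and coefficient 1. *)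
  have -> : (1 + b * x i.+1) * g + x i.+1 * (- b * g) = g by ring.
  by rewrite IH // => k hk; apply: hc; lia.
have {}ry : (r < y)%N by rewrite ltn_neqAle eq_sym yr.
have := @piop_groth_from_descent N tau (X ++ rev l) y r B.
rewrite -!catA hsX -/i => /(_ uw (ltnW hN) ry) ->.
rewrite mulrDr mulrDr piopsD; last by lia.
rewrite ev1D !(mulrA c) !IH //.
- by rewrite !ev1M ev1D ev1M ev1_1 ev1_b hx; ring.
- by move=> k hk; rewrite swapvM hcx // hc //; lia.
- by move=> k hk; rewrite swapvM swapvD swapvM swapv1 swapv_b hcx // hc //; lia.
Qed.

Lemma ev1_groth_from_min (X : seq nat) (m : nat) (R : seq nat) :
  uniq (X ++ m :: R) -> (size (X ++ m :: R) <= N)%N -> all (fun y => m < y)%N (X ++ R) ->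
  ev1 (groth_from (stair (size (X ++ m :: R))) (X ++ m :: R)) =
  hop (fun C => ev1 (groth_from (stair (size (X ++ R))) (X ++ C))) (rev R) [::].
Proof.
move=> uw hN hm.
have sub : subseq (X ++ R) (X ++ m :: R) by apply: cat_subseq => //; exact: subseq_cons.
have uXR := subseq_uniq sub uw.
have hs : size (X ++ m :: R) = (size (X ++ R)).+1 by rewrite !size_cat addnS.
have hsXR : size (X ++ R) = (size X + size R)%N by rewrite size_cat.
rewrite groth_from_min // hs stairS groth_from_mul; first last.
- by move=> i hi; apply: swapv_xprod_lt => //; lia.
- by lia.
have hsym i : ((size (X ++ R)).-1 <= i)%N ->
    swapv i (groth_from (stair (size (X ++ R))) (X ++ R)) =
      groth_from (stair (size (X ++ R))) (X ++ R).
  by move=> hi; apply: groth_from_stair_sym => //; lia.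
move: hsym; set tau := stair _ => hsym.
case/lastP: R uw hN hm sub uXR hs hsXR tau hsym => [|R r] uw hN hm sub uXR hs hsXR tau hsym.
  rewrite /hop /= !cats0 ev1M ev1_xprod ?mul1r //.
  by move: hN; rewrite size_cat /=; lia.
rewrite hsXR size_rcons piopsS addnS xprodS -mulrA piopM; first last.
- by apply: swapv_xprod_ge.
- by rewrite hs hsXR size_rcons in hN; lia.
(* By symmetry in the last variables the first operator contributes no factor, so the last letter
   [r] starts hopping with coefficient 1. *)
rewrite piop_x_sym; first last.
- by apply: hsym; rewrite hsXR size_rcons; lia.
- by rewrite hs hsXR size_rcons in hN; lia.
rewrite rev_rcons.
have := @ev1_piops tau X r (rev R) [::] 1.
rewrite revK size_rev cats1 ev1_1 !mul1r; apply=> //.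
- by rewrite hs in hN.
- by move=> i _; exact: swapv1.
Qed.

End Specialization.

Lemma hopr_ext phi phi' (r : nat) (l B : seq nat) :
  (forall C : seq nat, perm_eq C (r :: l ++ B) -> phi C = phi' C) ->
  hopr phi r l B = hopr phi' r l B.
Proof.
elim: l r B => [|y l IH] r B h /=; first by apply: h; rewrite perm_refl.
have h1 C : perm_eq C (y :: l ++ r :: B) -> phi C = phi' C.
  move=> hC; apply: h; apply: (perm_trans hC); apply/seq.permP => p.
  by rewrite /= !count_cat /=; lia.
have h2 C : perm_eq C (r :: l ++ y :: B) -> phi C = phi' C.
  move=> hC; apply: h; apply: (perm_trans hC); apply/seq.permP => p.
  by rewrite /= !count_cat /=; lia.
by rewrite !IH.
Qed.

Lemma hop_ext phi phi' (R : seq nat) : (forall C : seq nat, perm_eq C R -> phi C = phi' C) ->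
  hop phi (rev R) [::] = hop phi' (rev R) [::].
Proof.
case/lastP: R => [|R r] h; first by rewrite /hop /= h.
rewrite rev_rcons /hop; apply: hopr_ext => C hC; apply: h.
rewrite (perm_trans hC) // cats0 perm_sym perm_rcons perm_cons perm_sym.
by apply/seq.permP => p; rewrite count_rev.
Qed.

(** For any number of variables the values at ones obey the same recursion on the smallest letter.
    Thus [Upsilon], computed in as many variables as letters, is comparable across lengths. *)
Lemma ev1_groth_from_stable N N' (w : seq nat) : uniq w -> (size w <= N)%N -> (size w <= N')%N ->
  ev1 (groth_from (stair N (size w)) w) = ev1 (groth_from (stair N' (size w)) w).
Proof.
have [n] := ubnP (size w); elim: n w => // n IH w hn uw hN hN'.
case: (w =P [::]) => [->|/eqP wn].
  by rewrite !groth_from_sorted // /stair !big_geq // !ev1_1.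
have [X [m [R [ew hm]]]] := min_split uw wn; subst w.
have sub : subseq (X ++ R) (X ++ m :: R) by apply: cat_subseq => //; exact: subseq_cons.
have hs : size (X ++ m :: R) = (size (X ++ R)).+1 by rewrite !size_cat addnS.
rewrite !ev1_groth_from_min //; apply: hop_ext => C hC.
have pC : perm_eq (X ++ C) (X ++ R) by rewrite perm_cat2l.
have sC : size (X ++ C) = size (X ++ R) := perm_size pC.
rewrite -sC.
apply: IH; [lia| |lia|lia].
rewrite (perm_uniq pC); exact: subseq_uniq sub uw.
Qed.

Definition word_ups (w : seq nat) : Zb := Upsilon (stdperm w).

Transparent groth_from.

Lemma groth_fuel_from n k w : groth_fuel n k w = groth_from_fuel (topmon n) k w.
Proof.
elim: k w => //= k IH w; case: (first_ascent w) => // j; by rewrite IH.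
Qed.

Lemma Upsilon_groth_from w : Upsilon w = ev1 (groth_from (stair (size w) (size w)) w).
Proof. by rewrite /Upsilon /groth groth_fuel_from topmon_stair. Qed.

Lemma count_leq_mono (w : seq nat) :
  {in w &, {mono (fun y => count (fun z => z <= y)%N w) : y z / (y < z)%N}}.
Proof.
have mono y z : (y <= z)%N -> (count (fun t => t <= y) w <= count (fun t => t <= z) w)%N.
  by move=> yz; apply: sub_count => t /= h; exact: leq_trans h yz.
move=> y z yw zw; have [yz|zy] := ltnP y z; last by rewrite ltnNge mono.
have -> : count (fun t => t <= z)%N w =
    (count (fun t => t <= y)%N w + count (fun t => y < t <= z)%N w)%N.
  by elim: (w) => //= t w' ->; case: (leqP t y); case: (leqP t z) => /=; lia.
rewrite -[X in (X < _)%N]addn0 ltn_add2l -has_count.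
by apply/hasP; exists z => //; rewrite yz leqnn.
Qed.

Lemma word_upsE N (w : seq nat) : uniq w -> (size w <= N)%N ->
  word_ups w = ev1 (groth_from (stair N (size w)) w).
Proof.
move=> uw hN; rewrite /word_ups Upsilon_groth_from size_map.
rewrite (groth_from_mono _ (@count_leq_mono w)); exact: ev1_groth_from_stable.
Qed.

Lemma word_ups_min (X : seq nat) (m : nat) (R : seq nat) :
  uniq (X ++ m :: R) -> all (fun y => m < y)%N (X ++ R) ->
  word_ups (X ++ m :: R) = hop (fun C => word_ups (X ++ C)) (rev R) [::].
Proof.
move=> uw hm; rewrite (word_upsE uw (leqnn _)) ev1_groth_from_min //; apply: hop_ext => C hC.
have sub : subseq (X ++ R) (X ++ m :: R) by apply: cat_subseq => //; exact: subseq_cons.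
have pC : perm_eq (X ++ C) (X ++ R) by rewrite perm_cat2l.
rewrite -(perm_size pC) -word_upsE //.
  by rewrite (perm_uniq pC); exact: subseq_uniq sub uw.
by rewrite (perm_size pC); exact: size_subseq.
Qed.

(** * Conclusion for permutations avoiding 1423 *)

Unset Implicit Arguments.

Theorem theorem1p5 (w u : seq nat) :
  is_perm_word w -> avoids1423 w -> subseq u w ->
  nonneg_poly
    (\sum_(v <- subwords w | subseq u v)
        (-1) ^+ (size w - size v)%N * Upsilon (stdperm v)).
Proof.
move=> pw av uw.
have uniqw : uniq w by rewrite (perm_uniq pw) iota_uniq.
have ups_nil : word_ups [::] = 1.
  by rewrite (@word_upsE 0) // groth_from_sorted // /stair big_geq // ev1_1.
(* There is no occurrence of 1423 at all, so the condition holds vacuously for [u]. *)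
have guard : guarded u w.
  move=> a c q y s /andP[aq qy] yc; case: av; exists [:: a; c; q; y]; split=> //.
  have E (i j : nat) : (i < j)%N -> ((i <= j)%N = true) * ((j <= i)%N = false).
    by move=> h; split; lia.
  rewrite /stdperm /= !leqnn !(E _ _ aq) !(E _ _ qy) !(E _ _ yc).
  by rewrite !(E _ _ (ltn_trans qy yc)) !(E _ _ (ltn_trans aq qy))
    !(E _ _ (ltn_trans aq (ltn_trans qy yc))).
have := alternating_sum_tm (tm_guarded ups_nil word_ups_min uniqw guard) uniqw.
rewrite (perm_big _ (subwords_sublists uniqw)) /=.
congr nonneg_poly; rewrite [RHS]big_mkcond big_seq [RHS]big_seq /=; apply: eq_bigr => v.
rewrite mem_sublists => vw.
have uv : uniq v by exact: subseq_uniq vw uniqw.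
have ev : filter (mem v) w = v by apply/esym; apply/subseq_uniqP.
(* Since the letters of [w] are distinct, a subword of [w] whose letters all lie in [v] is a subword
   of [v]. *)
have -> : all (mem v) u = subseq u v.
  apply/idP/idP => [h|/mem_subseq h]; last by apply/allP => y; exact: h.
  have : subseq u (filter (mem v) w) by rewrite subseq_filter h.
  by rewrite ev.
rewrite ev /word_ups; case: ifP => _; by rewrite ?mulr1n ?mulr0n ?mulr0.
Qed.
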